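(* The Conjugacy Problem in the Grigorchuk group $\Gamma$ is decidable in $O(n^{8})$ time. That is, there is an algorithm which, given two words $u,v\in\{a,b,c,d\}^{*}$ of total length $n=|u|+|v|$, decides in $O(n^{8})$ elementary steps whether there exists $x\in\Gamma$ with $u=x^{-1}vx$ in $\Gamma$.
   Context: Let $\mathcal{T}$ be the infinite rooted regular binary tree with vertex set $\{0,1\}^{*}$ (finite binary words, the empty word being the root; two words are adjacent iff one is obtained from the other by appending one bit). The Grigorchuk group $\Gamma$ is the subgroup of $\mathrm{Aut}(\mathcal{T})$ generated by four automorphisms $a,b,c,d$ (all fixing the root) defined recursively on binary words $b_1b_2\ldots b_n$ by: - $a(b_1,b_2,\ldots,b_n)=(1-b_1,b_2,\ldots,b_n)$; - $b(b_1,\ldots,b_n)=(b_1,1-b_2,b_3,\ldots,b_n)$ if $b_1=0$, and $(b_1,c(b_2,\ldots,b_n))$ if $b_1=1$; - $c(b_1,\ldots,b_n)=(b_1,1-b_2,b_3,\ldots,b_n)$ if $b_1=0$, and $(b_1,d(b_2,\ldots,b_n))$ if $b_1=1$; - $d(b_1,\ldots,b_n)=(b_1,b_2,\ldots,b_n)$ if $b_1=0$, and $(b_1,b(b_2,\ldots,b_n))$ if $b_1=1$. Each generator is an involution, so every element of $\Gamma$ is represented by a word over the alphabet $\{a,b,c,d\}$. For a word $w$, $|w|$ denotes its length. Time is counted in elementary operations on words, in a standard model of computation. *)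

(* Defs.v *)
From HB Require Import structures.
From mathcomp Require Import all_boot.
From mathcomp Require Import boolp classical_sets.

Set Implicit Arguments.
Unset Strict Implicit.
Unset Printing Implicit Defensive.

Local Open Scope group_scope.

Definition vertex := seq bool.

Definition adjacent (u v : vertex) : Prop :=
  exists x : bool, v = rcons u x \/ u = rcons v x.

Record tree_aut := TreeAut {
  aut_fun :> vertex -> vertex;
  aut_inv : vertex -> vertex;
  aut_funK : cancel aut_fun aut_inv;
  aut_invK : cancel aut_inv aut_fun;
  aut_root : aut_fun [::] = [::];
  aut_adj : forall u v, adjacent u v <-> adjacent (aut_fun u) (aut_fun v)
}.

Lemma tree_autP (g h : tree_aut) : g =1 h -> g = h.
Proof.
case: g h => [f f' fK f'K f0 fA] [k k' kK k'K k0 kA] /= /funext fk.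
have {}fk : f = k by [].
move: fK f'K f0 fA; rewrite fk => fK f'K f0 fA.
have f'k' : f' = k' by apply/funext => u; rewrite -{1}[u]k'K fK.
move: fK f'K; rewrite f'k' => fK f'K.
by congr TreeAut; exact: Prop_irrelevance.
Qed.

HB.instance Definition _ := gen_eqMixin tree_aut.
HB.instance Definition _ := gen_choiceMixin tree_aut.

Definition aut_one : tree_aut :=
  @TreeAut id id (fun=> erefl) (fun=> erefl) erefl (fun _ _ => iff_refl _).

Section AutOps.
Variables g h : tree_aut.

Let mulK : cancel (g \o h) (aut_inv h \o aut_inv g).
Proof. by move=> u /=; rewrite !aut_funK. Qed.

Let mulVK : cancel (aut_inv h \o aut_inv g) (g \o h).
Proof. by move=> u /=; rewrite !aut_invK. Qed.

Let mul_root : (g \o h) [::] = [::].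
Proof. by rewrite /= !aut_root. Qed.

Let mul_adj u v : adjacent u v <-> adjacent ((g \o h) u) ((g \o h) v).
Proof. by rewrite (aut_adj h) (aut_adj g). Qed.

(* Automorphisms act on the left: (g * h) u = g (h u). *)
Definition aut_mul : tree_aut := TreeAut mulK mulVK mul_root mul_adj.

Let inv_root : aut_inv g [::] = [::].
Proof. by rewrite -{1}(aut_root g) aut_funK. Qed.

Let inv_adj u v : adjacent u v <-> adjacent (aut_inv g u) (aut_inv g v).
Proof. by rewrite (aut_adj g (aut_inv g u)) !aut_invK. Qed.

Definition aut_opp : tree_aut :=
  TreeAut (@aut_invK g) (@aut_funK g) inv_root inv_adj.

End AutOps.

Lemma aut_mulA : associative aut_mul.
Proof. by move=> f g h; apply: tree_autP. Qed.
Lemma aut_mul1 : left_id aut_one aut_mul.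
Proof. by move=> f; apply: tree_autP. Qed.
Lemma aut_mulr1 : right_id aut_one aut_mul.
Proof. by move=> f; apply: tree_autP. Qed.
Lemma aut_mulV : left_inverse aut_one aut_opp aut_mul.
Proof. by move=> f; apply: tree_autP => u /=; rewrite aut_funK. Qed.
Lemma aut_mulrV : right_inverse aut_one aut_opp aut_mul.
Proof. by move=> f; apply: tree_autP => u /=; rewrite aut_invK. Qed.

HB.instance Definition _ := isGroup.Build tree_aut
  aut_mulA aut_mul1 aut_mulr1 aut_mulV aut_mulrV.

Definition act_a (w : vertex) : vertex :=
  if w is x :: w' then ~~ x :: w' else [::].

Fixpoint act_b (w : vertex) : vertex :=
  match w with
  | [::] => [::]
  | false :: w' => false :: act_a w'
  | true :: w' => true :: act_c w'
  end
with act_c (w : vertex) : vertex :=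
  match w with
  | [::] => [::]
  | false :: w' => false :: act_a w'
  | true :: w' => true :: act_d w'
  end
with act_d (w : vertex) : vertex :=
  match w with
  | [::] => [::]
  | false :: w' => false :: w'
  | true :: w' => true :: act_b w'
  end.

Lemma act_aK : involutive act_a.
Proof. by case=> //= x w; rewrite negbK. Qed.

Lemma act_bcdK w :
  [/\ act_b (act_b w) = w, act_c (act_c w) = w & act_d (act_d w) = w].
Proof.
elim: w => [|[] w [IHb IHc IHd]] //=; first by rewrite IHb IHc IHd.
by rewrite act_aK.
Qed.

Lemma act_bK : involutive act_b. Proof. by move=> w; case: (act_bcdK w). Qed.
Lemma act_cK : involutive act_c. Proof. by move=> w; case: (act_bcdK w). Qed.
Lemma act_dK : involutive act_d. Proof. by move=> w; case: (act_bcdK w). Qed.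

Definition extends_edges (f : vertex -> vertex) :=
  forall w x, exists y, f (rcons w x) = rcons (f w) y.

Lemma act_a_edges : extends_edges act_a.
Proof. by move=> [|y w] x /=; [exists (~~ x) | exists x]. Qed.

Lemma act_bcd_edges w x :
  [/\ exists y, act_b (rcons w x) = rcons (act_b w) y,
      exists y, act_c (rcons w x) = rcons (act_c w) y
    & exists y, act_d (rcons w x) = rcons (act_d w) y].
Proof.
elim: w => [|[] w [[y1 e1] [y2 e2] [y3 e3]]] /=.
- by case: x; split; eexists.
- by rewrite e1 e2 e3; split; [exists y2 | exists y3 | exists y1].
- by have [y ->] := act_a_edges w x; split; [exists y | exists y | exists x].
Qed.

Lemma act_b_edges : extends_edges act_b.
Proof. by move=> w x; case: (act_bcd_edges w x). Qed.
Lemma act_c_edges : extends_edges act_c.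
Proof. by move=> w x; case: (act_bcd_edges w x). Qed.
Lemma act_d_edges : extends_edges act_d.
Proof. by move=> w x; case: (act_bcd_edges w x). Qed.

Lemma involutive_adj f : involutive f -> extends_edges f ->
  forall u v, adjacent u v <-> adjacent (f u) (f v).
Proof.
move=> fK fE.
suff half u v : adjacent u v -> adjacent (f u) (f v).
  by move=> u v; split=> [|/half]; [exact: half | rewrite !fK].
case=> x [->|->].
- by have [y ->] := fE u x; exists y; left.
- by have [y ->] := fE v x; exists y; right.
Qed.

Definition aut_a : tree_aut :=
  TreeAut act_aK act_aK erefl (involutive_adj act_aK act_a_edges).
Definition aut_b : tree_aut :=
  TreeAut act_bK act_bK erefl (involutive_adj act_bK act_b_edges).
Definition aut_c : tree_aut :=
  TreeAut act_cK act_cK erefl (involutive_adj act_cK act_c_edges).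
Definition aut_d : tree_aut :=
  TreeAut act_dK act_dK erefl (involutive_adj act_dK act_d_edges).

Definition is_subgroup (G : groupType) (H : set G) : Prop :=
  [/\ H 1, forall x y, H x -> H y -> H (x * y) & forall x, H x -> H x^-1].

Definition grigorchuk : set tree_aut :=
  smallest (@is_subgroup tree_aut)
    [set g | [\/ g = aut_a, g = aut_b, g = aut_c | g = aut_d]].

Inductive letter := La | Lb | Lc | Ld.

Definition ord_of_letter (l : letter) : 'I_4 :=
  match l with La => inord 0 | Lb => inord 1 | Lc => inord 2 | Ld => inord 3 end.
Definition letter_of_ord (i : 'I_4) : letter := nth La [:: La; Lb; Lc; Ld] i.
Lemma ord_of_letterK : cancel ord_of_letter letter_of_ord.
Proof. by case; rewrite /letter_of_ord /= inordK. Qed.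
HB.instance Definition _ := Finite.copy letter (can_type ord_of_letterK).

Definition aut_of_letter (l : letter) : tree_aut :=
  match l with La => aut_a | Lb => aut_b | Lc => aut_c | Ld => aut_d end.

Definition aut_of_word (w : seq letter) : tree_aut :=
  \prod_(l <- w) aut_of_letter l.

Definition conjugate_in_grigorchuk (u v : seq letter) : Prop :=
  exists2 x : tree_aut, grigorchuk x &
    aut_of_word u = x^-1 * aut_of_word v * x.

Section TuringMachine.
Variable Sigma : finType.

(* Tape cells hold [None] (blank), an input letter, or an auxiliary symbol. *)
Definition cell (aux : finType) : finType := option (Sigma + aux)%type.

Variant move := MoveLeft | Stay | MoveRight.

Record turing_machine := TuringMachine {
  tm_tapes : nat;  (* work tapes; the input tape is an additional one *)
  tm_aux : finType;
  tm_state : finType;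
  tm_start : tm_state;
  (* [Some b]: halting state with answer [b]; [None]: not halting *)
  tm_answer : tm_state -> option bool;
  tm_trans : tm_state -> {ffun 'I_tm_tapes.+1 -> cell tm_aux} ->
    tm_state * ('I_tm_tapes.+1 -> cell tm_aux * move)
}.

(* A two-way infinite tape: the cells to the left of the head (nearest first),
   the scanned cell, the cells to its right; all remaining cells are blank. *)
Record tape (aux : finType) := Tape {
  tape_left : seq (cell aux);
  tape_head : cell aux;
  tape_right : seq (cell aux)
}.

Definition write_move (aux : finType) (t : tape aux) (s : cell aux) (m : move) :
    tape aux :=
  let: Tape l _ r := t in
  match m with
  | MoveLeft => Tape (behead l) (head None l) (s :: r)
  | Stay => Tape l s r
  | MoveRight => Tape (s :: l) (head None r) (behead r)
  end.

Variable M : turing_machine.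

Record config := Config {
  cfg_state : tm_state M;
  cfg_tapes : 'I_(tm_tapes M).+1 -> tape (tm_aux M)
}.

Definition init_config (w : seq Sigma) : config :=
  Config (tm_start M) (fun i =>
    let cells := if i == ord0 then [seq Some (inl x) | x <- w] else [::] in
    Tape [::] (head None cells) (behead cells)).

Definition step (c : config) : config :=
  if tm_answer (cfg_state c) is Some _ then c else
  let: (q, act) :=
    tm_trans (cfg_state c) [ffun i => tape_head (cfg_tapes c i)] in
  Config q (fun i => write_move (cfg_tapes c i) (act i).1 (act i).2).

Definition answers_within (w : seq Sigma) (t : nat) (b : bool) : Prop :=
  exists2 k, k <= t &
    tm_answer (cfg_state (iter k step (init_config w))) = Some b.

End TuringMachine.

(* [None] separates the two words. *)
Definition encode_pair (A : finType) (u v : seq A) : seq (option A) :=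
  [seq Some x | x <- u] ++ None :: [seq Some x | x <- v].

Definition decidable_in_time (A : finType) (P : seq A -> seq A -> Prop)
    (T : nat -> nat) : Prop :=
  exists M : turing_machine (option A), forall u v : seq A,
    exists2 b : bool,
      answers_within M (encode_pair u v) (T (size u + size v)) b & (b <-> P u v).

Definition big_O (f g : nat -> nat) : Prop :=
  exists C N : nat, forall n, N <= n -> (f n <= C * g n)%N.

(* Main.v *)
(* Let K be the normal closure of (ab)^2: it has finite index and contains
   K x K (acting on the two subtrees). For words u, v let Q(u, v) be the set of
   cosets of K that contain some x with x u = v x. If u and v fix the first
   level, with sections u_0, u_1, v_0, v_1, then Q(u, v) is determined by the
   Q(u_i, v_j), because K x K <= K makes gluing two section conjugators depend
   only on their cosets. If u and v both move the first level, Q(u, v) is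
   determined by Q(u_1 u_0, v_1 v_0) and by the cosets of some sections. For a
   suitable weighting of the letters, each such reduction yields at most four
   pairs, each of weight at most 14/17 of the original up to a constant. Since
   4 (5/6)^8 < 1, the potential A m^8 + B of a pair of weight m pays for reading
   the pair and for the potentials of its at most four subproblems; pairs of
   short words are looked up in a finite table. *)

From HB Require Import structures.
Require Import Defs.
From mathcomp Require Import all_boot.
From mathcomp Require Import boolp zify.

Set Implicit Arguments.
Unset Strict Implicit.
Unset Printing Implicit Defensive.

(** * Stack machines *)

Lemma nth_head_behead (T : Type) (x : T) (s : seq T) i :
  nth x (head x s :: behead s) i = nth x s i.
Proof. by case: s i => [|y s] [|i] //=; rewrite nth_nil. Qed.

Lemma onth_behead (T : Type) (s : seq T) i : onth (behead s) i = onth s i.+1.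
Proof. by case: s i => [|y s] []. Qed.

Section StackMachine.
Variables Sigma J aux Q : finType.
Notation sym := (Sigma + aux)%type.

Variant stack_op := Keep | Pop | Push of sym | Replace of sym.

Variables (start : Q) (answer : Q -> option bool)
  (trans : Q -> (option J -> option sym) -> Q * (option J -> stack_op)).

Definition apply_op (o : stack_op) (s : seq sym) : seq sym :=
  match o with
  | Keep => s | Pop => behead s | Push x => x :: s | Replace x => x :: behead s
  end.

Definition stack_config := (Q * (option J -> seq sym))%type.

Definition stack_step (c : stack_config) : stack_config :=
  if answer c.1 is Some _ then c else
  let: (q, ops) := trans c.1 (fun j => ohead (c.2 j)) in
  (q, fun j => apply_op (ops j) (c.2 j)).

(** * Simulation of stacks by the tapes of a Turing machine *)

Definition stack_of_tape (i : 'I_#|J|.+1) : option J :=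
  omap enum_val (unlift ord0 i).
Definition tape_of_stack (j : option J) : 'I_#|J|.+1 :=
  if j is Some j' then lift ord0 (enum_rank j') else ord0.

Lemma tape_of_stackK : cancel tape_of_stack stack_of_tape.
Proof.
rewrite /stack_of_tape => -[j|] /=; last by rewrite unlift_none.
by rewrite liftK /= enum_rankK.
Qed.

Definition stack_tm_state := (Q + Q * {ffun option J -> option sym})%type.

(* A stack is the part of a tape from the head rightwards. Pushing takes two
   steps, one to move left and one to write, so all steps are doubled. *)
Definition stack_tm_trans (s : stack_tm_state)
    (h : {ffun 'I_#|J|.+1 -> cell Sigma aux}) :
    stack_tm_state * ('I_#|J|.+1 -> cell Sigma aux * move) :=
  match s with
  | inl q =>
    let: (q', ops) := trans q (fun j => h (tape_of_stack j)) in
    (inr (q', [ffun j => if ops j is Push x then Some x else None]),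
     fun i => match ops (stack_of_tape i) with
       | Keep => (h i, Stay)
       | Pop => (None, MoveRight)
       | Push _ => (h i, MoveLeft)
       | Replace x => (Some x, Stay)
       end)
  | inr (q, pending) =>
    (inl q, fun i =>
      (if pending (stack_of_tape i) is Some x then Some x else h i, Stay))
  end.

Definition stack_tm : turing_machine Sigma :=
  @TuringMachine Sigma #|J| aux stack_tm_state (inl start)
    (fun s => if s is inl q then answer q else None) stack_tm_trans.

(** The cells to the left of the head are unconstrained: a push overwrites the cell it moves
    onto. *)
Definition tape_holds (t : tape Sigma aux) (s : seq sym) : Prop :=
  forall i, nth None (tape_head t :: tape_right t) i = onth s i.

Definition simulates (c : config stack_tm) (d : stack_config) : Prop :=
  cfg_state c = inl d.1 :> stack_tm_state /\
  forall j, tape_holds (cfg_tapes c (tape_of_stack j)) (d.2 j).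

Lemma tape_holds_head t s : tape_holds t s -> tape_head t = ohead s.
Proof. by move=> /(_ 0) /= ->; case: s. Qed.

Lemma simulates_step c d : simulates c d -> answer d.1 = None ->
  simulates (iter 2 (@step _ _) c) (stack_step d).
Proof.
case: c d => qc tc [q st] [/= -> tst] aq.
rewrite /stack_step /= aq /= /step /= aq.
set h := [ffun i => _].
have -> : (fun j => h (tape_of_stack j)) = (fun j => ohead (st j)).
  by apply/funext => j; rewrite ffunE (tape_holds_head (tst j)).
case: trans => q' ops /=; split=> //= j i.
have := tst j; rewrite !ffunE tape_of_stackK.
case: (tc _) => l x r /= tj.
case: (ops j) => [||y|y] /=.
- exact: tj.
- by rewrite nth_head_behead onth_behead -tj.
- by case: i => [|i]; last exact: tj.
- by case: i => [|i] //=; rewrite onth_behead -tj.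
Qed.

Definition stack_init (w : seq Sigma) : stack_config :=
  (start, fun j => if j is None then [seq inl x | x <- w] else [::]).

Lemma simulates_init w : simulates (init_config stack_tm w) (stack_init w).
Proof.
split=> // -[j|] i; rewrite nth_head_behead; last by rewrite onthE -map_comp.
by rewrite /= nth_nil onth0n.
Qed.

Lemma stack_tm_answers w k b :
  answer (iter k stack_step (stack_init w)).1 = Some b ->
  answers_within stack_tm w k.*2 b.
Proof.
(* Strong induction: the simulation only passes through running configurations, so an earlier halt
   is left to the hypothesis at that time, when the answer is already [b]. *)
elim: k {-2}k (leqnn k) => [|k IHk] k' kk' ab.
  move: kk' ab; rewrite leqn0 => /eqP -> /= ab.
  by exists 0 => //=; rewrite ab.
pose d i := iter i stack_step (stack_init w).
have sim j : (forall i, i < j -> answer (d i).1 = None) ->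
    simulates (iter j.*2 (@step _ _) (init_config stack_tm w)) (d j).
  elim: j => [_|j IHj none]; first exact: simulates_init.
  rewrite doubleS -addn2 addnC iterD iterS; apply: simulates_step.
    by apply: IHj => i ij; apply: none; apply: ltnW.
  exact: none.
have [|] := pselect (forall i, i < k' -> answer (d i).1 = None).
  move=> /sim [e _]; exists k'.*2 => //=; rewrite /tm_answer /= e; exact: ab.
move=> /existsNP[i] /not_implyP[ik'].
case ei: answer => [b'|] // _.
have bb' : b = b'.
  move: ab; rewrite -(subnK (ltnW ik')) iterD.
  have halted n : iter n stack_step (d i) = d i.
    by elim: n => //= n ->; rewrite /stack_step ei.
  by rewrite -/(d i) halted ei => -[].
have [||j ji ?] := IHk i.
- lia.
- by rewrite ei bb'.
by exists j => //; lia.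
Qed.

End StackMachine.

(** * A divide-and-conquer machine *)

(** Products of two generators: [None] if nothing simplifies, [Some None] if they cancel, otherwise
    their product in the Klein four-group {1, b, c, d}. *)
Definition fuse (x y : letter) : option (option letter) :=
  match x, y with
  | La, La | Lb, Lb | Lc, Lc | Ld, Ld => Some None
  | La, _ | _, La => None
  | Lb, Lc | Lc, Lb => Some (Some Ld)
  | Lb, Ld | Ld, Lb => Some (Some Lc)
  | Lc, Ld | Ld, Lc => Some (Some Lb)
  end.

(** A fusion needs no cascade: in a reduced stack a letter other than [La] has only an [La], or
    nothing, below it. *)
Definition push_letter (s : seq letter) (x : letter) : seq letter :=
  if s is y :: s' then
    match fuse y x with
    | None => x :: s
    | Some None => s'
    | Some (Some z) => z :: s'
    end
  else [:: x].

(* The reduced form is built on a stack, hence comes out reversed. *)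
Definition reduce : seq letter -> seq letter := foldl push_letter [::].

Section DivideAndConquer.
Variables info value op1 op2 : finType.

(** Tasks are written in postfix notation: operators act on the stack of values, and [End] closes a
    pair of words. *)
Variant task_symbol :=
  End | Val of value | Un of op1 | Bin of op2.

Definition task_symbol_code (a : task_symbol) : unit + value + op1 + op2 :=
  match a with
  | End => inl (inl (inl tt)) | Val v => inl (inl (inr v))
  | Un o => inl (inr o) | Bin o => inr o
  end.
Definition task_symbol_decode (a : unit + value + op1 + op2) : task_symbol :=
  match a with
  | inl (inl (inl tt)) => End | inl (inl (inr v)) => Val v
  | inl (inr o) => Un o | inr o => Bin o
  end.
Lemma task_symbol_codeK : cancel task_symbol_code task_symbol_decode.
Proof. by do ?case. Qed.
HB.instance Definition _ :=
  Finite.copy task_symbol (can_type task_symbol_codeK).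

Local Notation sym := (option letter + task_symbol)%type.
Definition letter_sym (l : letter) : sym := inl (Some l).
Definition separator : sym := inl None.
Definition value_sym (v : value) : sym := inr (Val v).

(* Work stacks: [R] receives a reduced word, [S] holds the values computed so
   far, and [(side, part, copy)] a copy of a section of the word [side]. *)
Definition buffer := (bool * bool * bool)%type.
Definition work_stack := (bool + buffer)%type.
Local Notation R := (Some (inl false) : option work_stack).
Local Notation S := (Some (inl true) : option work_stack).

Variant instr := Emit of sym | Unload of buffer.

Variables (script_bound : nat) (script : info -> info -> seq instr).
Hypothesis script_size : forall i j, size (script i j) <= script_bound.
Variables (info0 : info) (info_step : info -> letter -> info)
  (emit : info -> letter -> bool -> option letter)
  (eval1 : op1 -> value -> value) (eval2 : op2 -> value -> value -> value)
  (accept : value -> bool).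

(* [Read None] and [Split None _] treat the first word of a pair; for the second
   word, [Some i] remembers the state [i] reached on the first. *)
Variant phase :=
  | Main
  | Read of option info
  | Split of option info & info
  | Script of info & info & 'I_script_bound.+1
  | Clear
  | Operand of op2 & value
  | Done of bool.

Definition phase_code (q : phase) : unit + option info + option info * info +
    info * info * 'I_script_bound.+1 + unit + op2 * value + bool :=
  match q with
  | Main => inl (inl (inl (inl (inl (inl tt)))))
  | Read o => inl (inl (inl (inl (inl (inr o)))))
  | Split o i => inl (inl (inl (inl (inr (o, i)))))
  | Script i j n => inl (inl (inl (inr (i, j, n))))
  | Clear => inl (inl (inr tt))
  | Operand o x => inl (inr (o, x))
  | Done b => inr b
  end.
Definition phase_decode q : phase :=
  match q with
  | inl (inl (inl (inl (inl (inl tt))))) => Main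
  | inl (inl (inl (inl (inl (inr o))))) => Read o
  | inl (inl (inl (inl (inr (o, i))))) => Split o i
  | inl (inl (inl (inr (i, j, n)))) => Script i j n
  | inl (inl (inr tt)) => Clear
  | inl (inr (o, x)) => Operand o x
  | inr b => Done b
  end.
Lemma phase_codeK : cancel phase_code phase_decode.
Proof. by do ?case. Qed.
HB.instance Definition _ := Finite.copy phase (can_type phase_codeK).

Local Notation op := (stack_op (option letter) task_symbol).
Local Notation keep := (@Keep (option letter) task_symbol).
Local Notation pop := (@Pop (option letter) task_symbol).

Definition ops (oW oR oS : op) (oP : buffer -> op) : option work_stack -> op :=
  fun j => match j with
  | None => oW
  | Some (inl false) => oR
  | Some (inl true) => oS
  | Some (inr p) => oP p
  end.

Definition push_letter_op (top : option sym) (l : letter) : op :=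
  if top is Some (inl (Some y)) then
    match fuse y l with
    | None => Push (letter_sym l)
    | Some None => Pop _ _
    | Some (Some z) => Replace (letter_sym z)
    end
  else Push (letter_sym l).

Definition emit_op (side : bool) (i : info) (l : letter) (p : buffer) : op :=
  if p.1.1 == side then
    if emit i l p.1.2 is Some x then Push (letter_sym x) else Keep _ _
  else Keep _ _.

(* Popping an empty stack has no effect, so [Read] accepts the bottom of the
   stack in place of [End]; hence the input is itself a pair. *)
Definition trans (q : phase) (top : option work_stack -> option sym) :
    phase * (option work_stack -> op) :=
  match q with
  | Main =>
    match top None with
    | None => (Done (if top S is Some (inr (Val v)) then accept v else false),
               ops keep keep keep (fun=> keep))
    | Some (inl _) => (Read None, ops keep keep keep (fun=> keep))
    | Some (inr End) => (Main, ops pop keep keep (fun=> keep))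
    | Some (inr (Val v)) =>
      (Main, ops pop keep (Push (value_sym v)) (fun=> keep))
    | Some (inr (Un o)) =>
      (Main, ops pop keep
        (if top S is Some (inr (Val v)) then Replace (value_sym (eval1 o v))
         else keep) (fun=> keep))
    | Some (inr (Bin o)) =>
      (if top S is Some (inr (Val v)) then Operand o v else Main,
       ops pop keep pop (fun=> keep))
    end
  | Read o =>
    if top None is Some (inl (Some l)) then
      (Read o, ops pop (push_letter_op (top R) l) keep (fun=> keep))
    else (Split o info0, ops pop keep keep (fun=> keep))
  | Split o i =>
    if top R is Some (inl (Some l)) then
      (Split o (info_step i l), ops keep pop keep (emit_op (isSome o) i l))
    else (if o is Some i' then Script i' i ord0 else Read (Some i),
          ops keep keep keep (fun=> keep))
  | Script i j n =>
    match onth (script i j) n with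
    | None => (Clear, ops keep keep keep (fun=> keep))
    | Some (Emit s) =>
      (Script i j (inord n.+1), ops (Push s) keep keep (fun=> keep))
    | Some (Unload p) =>
      if top (Some (inr p)) is Some (inl (Some l)) then
        (Script i j n, ops (Push (letter_sym l)) keep keep
          (fun p' => if p' == p then pop else keep))
      else (Script i j (inord n.+1), ops keep keep keep (fun=> keep))
    end
  | Clear =>
    if [exists p : buffer, isSome (top (Some (inr p)))] then
      (Clear, ops keep keep keep (fun=> pop))
    else (Main, ops keep keep keep (fun=> keep))
  | Operand o x =>
    (Main, ops keep keep
      (if top S is Some (inr (Val y)) then Replace (value_sym (eval2 o x y))
       else keep) (fun=> keep))
  | Done b => (Done b, ops keep keep keep (fun=> keep))
  end.

Definition phase_answer (q : phase) : option bool :=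
  if q is Done b then Some b else None.

Local Notation step := (stack_step phase_answer trans).

Definition conf (q : phase) (w : seq sym) (r : seq letter) (s : seq value)
    (p : buffer -> seq letter) :
    stack_config (option letter) work_stack task_symbol phase :=
  (q, fun j => match j with
   | None => w
   | Some (inl false) => map letter_sym r
   | Some (inl true) => map value_sym s
   | Some (inr x) => map letter_sym (p x)
   end).

(** * Running time of the phases *)

Definition reaches (k : nat) c c' := exists2 j, j <= k & iter j step c = c'.

Lemma reaches_trans c2 k1 k2 c1 c3 :
  reaches k1 c1 c2 -> reaches k2 c2 c3 -> reaches (k1 + k2) c1 c3.
Proof.
move=> [j1 le1 e1] [j2 le2 e2]; exists (j2 + j1); first lia.
by rewrite iterD e1.
Qed.

Lemma reaches_step k c c' : reaches k (step c) c' -> reaches k.+1 c c'.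
Proof. by move=> [j le_jk e]; exists j.+1 => //; rewrite iterSr. Qed.

Lemma reaches_refl k c : reaches k c c.
Proof. by exists 0. Qed.

Lemma reaches_leq k k' c c' : k <= k' -> reaches k c c' -> reaches k' c c'.
Proof. by move=> le_k [j le_j e]; exists j => //; lia. Qed.

Definition is_letter_sym (s : option sym) : bool :=
  if s is Some (inl (Some _)) then true else false.

(** One goal per stack, so that callers need not compare functions on all stacks at once. *)
Lemma reaches_conf oW oR oS oP p' q' w' r' s' k q w r s p c :
  reaches k (conf q' w' r' s' p') c ->
  phase_answer q = None ->
  trans q (fun j => ohead ((conf q w r s p).2 j)) = (q', ops oW oR oS oP) ->
  apply_op oW w = w' ->
  apply_op oR (map letter_sym r) = map letter_sym r' ->
  apply_op oS (map value_sym s) = map value_sym s' ->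
  (forall x, apply_op (oP x) (map letter_sym (p x)) = map letter_sym (p' x)) ->
  reaches k.+1 (conf q w r s p) c.
Proof.
move=> run_c nq tq eW eR eS eP; apply: reaches_step.
suff -> : step (conf q w r s p) = conf q' w' r' s' p' by [].
rewrite /stack_step /= nq tq /conf; congr pair.
by apply/funext => -[[[]|x]|] /=.
Qed.
Arguments reaches_conf oW oR oS oP {p' q' w' r' s' k q w r s p c}.

Lemma reaches_conf1 oW oR oS oP q w r s p q' w' r' s' p' :
  phase_answer q = None ->
  trans q (fun j => ohead ((conf q w r s p).2 j)) = (q', ops oW oR oS oP) ->
  apply_op oW w = w' ->
  apply_op oR (map letter_sym r) = map letter_sym r' ->
  apply_op oS (map value_sym s) = map value_sym s' ->
  (forall x, apply_op (oP x) (map letter_sym (p x)) = map letter_sym (p' x)) ->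
  reaches 1 (conf q w r s p) (conf q' w' r' s' p').
Proof.
move=> nq tq eW eR eS eP.
exact: reaches_conf (reaches_refl _ _) nq tq eW eR eS eP.
Qed.
Arguments reaches_conf1 oW oR oS oP {q w r s p q' w' r' s' p'}.

Lemma reaches_Read o u t r s p : ~~ is_letter_sym (ohead t) ->
  reaches (size u).+1 (conf (Read o) (map letter_sym u ++ t) r s p)
    (conf (Split o info0) (behead t) (foldl push_letter r u) s p).
Proof.
move=> nt; elim: u r => [|l u IHu] r /=.
  apply: (reaches_conf1 pop keep keep (fun=> keep)) => //=.
  by case: (ohead t) nt => [[[]|]|].
apply: (reaches_conf pop (push_letter_op (ohead (map letter_sym r)) l) keep
  (fun=> keep) (IHu _)) => //=.
by case: r => [|y r] //=; case: fuse => [[]|].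
Qed.

Fixpoint emitted (i : info) (part : bool) (r : seq letter) : seq letter :=
  if r is l :: r' then
    let t := emitted (info_step i l) part r' in
    if emit i l part is Some x then x :: t else t
  else [::].

Lemma reaches_Split o i w r s p :
  reaches (size r).+1 (conf (Split o i) w r s p)
    (conf (if o is Some i' then Script i' (foldl info_step i r) ord0
           else Read (Some (foldl info_step i r)))
       w [::] s (fun x => if x.1.1 == isSome o then
                   catrev (emitted i x.1.2 r) (p x) else p x)).
Proof.
elim: r i p => [|l r IHr] i p /=.
  apply: (reaches_conf1 keep keep keep (fun=> keep)); rewrite //=.
  by move=> x; case: ifP.
pose p1 x := if x.1.1 == isSome o then
  if emit i l x.1.2 is Some y then y :: p x else p x else p x.
apply: (reaches_conf keep pop keep (emit_op (isSome o) i l) (p' := p1)) => //=;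
  last by move=> x; rewrite /emit_op /p1; case: eqP => //; case: emit.
move: (IHr (info_step i l) p1); congr reaches; congr conf; apply/funext => x.
by rewrite /p1; case: eqP => //; case: emit.
Qed.

Fixpoint run (sc : seq instr) (w : seq sym) (p : buffer -> seq letter) :=
  match sc with
  | [::] => w
  | Emit x :: sc' => run sc' (x :: w) p
  | Unload x :: sc' =>
    run sc' (map letter_sym (rev (p x)) ++ w)
      (fun y => if y == x then [::] else p y)
  end.

Lemma reaches_Unload i j (n : 'I_script_bound.+1) x w s p :
  onth (script i j) n = Some (Unload x) ->
  reaches (size (p x)).+1 (conf (Script i j n) w [::] s p)
    (conf (Script i j (inord n.+1)) (map letter_sym (rev (p x)) ++ w) [::] s
       (fun y => if y == x then [::] else p y)).
Proof.
move=> def_n; move def_l: (p x) => l.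
elim: l w p def_l => [|y l IHl] w p px /=.
  apply: (reaches_conf1 keep keep keep (fun=> keep));
    rewrite //= ?def_n /= ?px //.
  by move=> z; case: eqP => // ->; rewrite px.
pose p1 z := if z == x then l else p z.
have := IHl (letter_sym y :: w) p1; rewrite {1}/p1 eqxx => /(_ erefl) run_l.
rewrite rev_cons map_rcons cat_rcons.
have -> : (fun z => if z == x then [::] else p z) =
          (fun z => if z == x then [::] else p1 z).
  by apply/funext => z; rewrite /p1; case: eqP.
apply: (reaches_conf (Push (letter_sym y)) keep keep
  (fun z => if z == x then pop else keep) run_l); rewrite //= ?def_n /= ?px //.
by move=> z; rewrite /p1; case: eqP => // ->; rewrite px.
Qed.

(** [done] is the executed prefix, whose size is the program counter. Each instruction takes at most
    [b.+1] steps, and the leftover buffers stay bounded for the clearing phase. *)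
Lemma reaches_Script b i j sc done w s p :
  script i j = done ++ sc -> (forall x, size (p x) <= b) ->
  exists p', (forall x, size (p' x) <= b) /\
  reaches (size sc * b.+1).+1 (conf (Script i j (inord (size done))) w [::] s p)
    (conf Clear (run sc w p) [::] s p').
Proof.
elim: sc done w p => [|ins sc IHsc] done w p def_sc le_p /=.
  exists p; split=> //.
  apply: (@reaches_leq 1) => //.
  apply: (reaches_conf1 keep keep keep (fun=> keep));
    rewrite //= onth_default // def_sc cats0.
  by rewrite inordK // ltnS -[done]cats0 -def_sc.
have lt_n : size done < script_bound.+1.
  rewrite ltnS; apply: leq_trans (script_size i j).
  by rewrite def_sc size_cat leq_addr.
have def_n :
    onth (script i j) (inord (size done) : 'I_script_bound.+1) = Some ins.
  by rewrite inordK // def_sc onth_cat ltnn subnn.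
have next w1 p1 : (forall x, size (p1 x) <= b) -> exists p',
    (forall x, size (p' x) <= b) /\ reaches (size sc * b.+1).+1
       (conf (Script i j (inord (size done).+1)) w1 [::] s p1)
       (conf Clear (run sc w1 p1) [::] s p').
  by move=> /(IHsc (rcons done ins) w1); rewrite cat_rcons size_rcons; apply.
case: ins def_sc def_n => [a|x] def_sc def_n.
  have [p' [le_p' run_p']] := next (a :: w) p le_p; exists p'; split=> //.
  apply: (@reaches_leq (size sc * b.+1).+2); first by lia.
  apply: (reaches_conf (Push a) keep keep (fun=> keep) run_p');
    by rewrite //= ?def_n //= inordK.
have [|p' [le_p' run_p']] := next (map letter_sym (rev (p x)) ++ w)
  (fun y => if y == x then [::] else p y).
  by move=> y; case: eqP.
exists p'; split=> //.
apply: (@reaches_leq ((size (p x)).+1 + (size sc * b.+1).+1)).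
  by have := le_p x; lia.
apply: reaches_trans run_p'; have := reaches_Unload w s p def_n.
by rewrite inordK.
Qed.

Lemma reaches_Clear b w s p : (forall x, size (p x) <= b) ->
  reaches b.+1 (conf Clear w [::] s p) (conf Main w [::] s (fun=> [::])).
Proof.
elim: b p => [|b IHb] p le_p.
  have p0 x : p x = [::] by apply/size0nil/eqP; rewrite -leqn0.
  apply: (reaches_conf1 keep keep keep (fun=> keep)); rewrite //=.
    by case: existsP => // -[x]; rewrite p0.
  by move=> x; rewrite p0.
have [nz|z] := boolP [exists x, isSome (ohead (map letter_sym (p x)))].
  have le_p' x : size (behead (p x)) <= b.
    by rewrite size_behead; have := le_p x; lia.
  apply: (reaches_conf keep keep keep (fun=> pop) (IHb _ le_p')) => //=.
    by rewrite nz.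
  by move=> x; case: (p x).
apply: (@reaches_leq 1) => //.
apply: (reaches_conf1 keep keep keep (fun=> keep)); rewrite //= ?(negPf z) //.
by move=> x; move/existsPn: z => /(_ x); case: (p x).
Qed.

Definition split_buffers (u v : seq letter) (x : buffer) : seq letter :=
  rev (emitted info0 x.1.2 (reduce (if x.1.1 then v else u))).

Definition word_info (u : seq letter) : info :=
  foldl info_step info0 (reduce u).

Lemma size_reduce u : size (reduce u) <= size u.
Proof.
rewrite /reduce -[leqRHS]add0n -[in leqRHS]/(size (Nil letter)).
elim: u [::] => [|l u IHu] r /=; first by rewrite addn0.
apply: leq_trans (IHu _) _; rewrite addnS -addSn leq_add2r.
by case: r => //= y r; case: fuse => [[]|] //=; lia.
Qed.

Lemma size_emitted i part r : size (emitted i part r) <= size r.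
Proof.
elim: r i => //= l r IHr i; case: emit => [x|] /=; first exact: IHr.
exact: leqW.
Qed.

Lemma reaches_task u v t s : ~~ is_letter_sym (ohead t) ->
  reaches ((script_bound + 10) * (size u + size v).+1)
    (conf Main (map letter_sym u ++ separator :: map letter_sym v ++ t)
       [::] s (fun=> [::]))
    (conf Main (run (script (word_info u) (word_info v)) (behead t)
       (split_buffers u v)) [::] s (fun=> [::])).
Proof.
move=> nt; set b := size u + size v; set i := word_info u; set j := word_info v.
have le_u := size_reduce u; have le_v := size_reduce v.
have le_b x : size (split_buffers u v x) <= b.
  rewrite size_rev; apply: leq_trans (size_emitted _ _ _) _.
  by case: ifP => _; lia.
have [p' [le_p' run_p']] :=
  reaches_Script (behead t) s (erefl : script i j = [::] ++ script i j) le_b.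
(* The entry step, reading and splitting of each word, the script, and the clearing. *)
apply: (@reaches_leq (1 + ((size u).+1 + ((size (reduce u)).+1 + ((size v).+1 +
  ((size (reduce v)).+1 + ((size (script i j) * b.+1).+1 + b.+1))))))).
  have := leq_mul (script_size i j) (leqnn b.+1); lia.
apply: (reaches_trans (c2 := conf (Read None)
    (map letter_sym u ++ separator :: map letter_sym v ++ t) [::] s
    (fun=> [::]))).
  apply: (reaches_conf1 keep keep keep (fun=> keep)) => //=.
  by case: (u).
apply: (reaches_trans (@reaches_Read _ u (separator :: _) _ _ _ isT)).
apply: (reaches_trans (reaches_Split _ _ _ _ _ _)) => /=.
apply: (reaches_trans (@reaches_Read _ v _ _ _ _ nt)).
apply: (reaches_trans (reaches_Split _ _ _ _ _ _)) => /=.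
have -> : (ord0 : 'I_script_bound.+1) = inord (size (Nil instr)).
  by apply: val_inj; rewrite /= inordK.
apply: (reaches_trans _ (reaches_Clear _ _ le_p')).
move: run_p'; congr reaches; congr conf.
apply/funext => -[[side part] copy] /=.
by case: side.
Qed.

(** * Evaluation of a list of tasks *)

Variant task := Pair of seq letter & seq letter | Symbol of task_symbol.

Definition task_code (t : task) : seq sym :=
  match t with
  | Pair u v =>
    map letter_sym u ++ separator :: map letter_sym v ++ [:: inr End]
  | Symbol a => [:: inr a]
  end.

Variable solve : seq letter -> seq letter -> value.

(** The cases with too few values mirror the machine, so that [exec] agrees with it on every
    stack. *)
Definition exec (s : seq value) (t : task) : seq value :=
  match t with
  | Pair u v => solve u v :: s
  | Symbol End => s
  | Symbol (Val x) => x :: s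
  | Symbol (Un o) => if s is x :: s' then eval1 o x :: s' else s
  | Symbol (Bin o) =>
    if s is x :: s' then if s' is y :: s'' then eval2 o x y :: s'' else s'
    else s
  end.

Definition answer_of (s : seq value) : bool :=
  if s is x :: _ then accept x else false.

Variables (subtasks : seq letter -> seq letter -> seq task)
  (cost : seq letter -> seq letter -> nat).

(** The 2 is for binary operators, which pass through the phase [Operand]. *)
Definition task_cost (t : task) : nat := if t is Pair u v then cost u v else 2.

Hypothesis run_script : forall u v w,
  run (script (word_info u) (word_info v)) w (split_buffers u v) =
  flatten (map task_code (subtasks u v)) ++ w.
Hypothesis exec_subtasks : forall u v s,
  foldl exec s (subtasks u v) = solve u v :: s.
Hypothesis cost_subtasks : forall u v,
  (script_bound + 10) * (size u + size v).+1 +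
    sumn (map task_cost (subtasks u v)) <= cost u v.

(** Strong induction on the total cost: expanding a pair spends [K > 0] steps and leaves subtasks
    that cost at most the rest, so the cost bounds the time and gives termination. *)
Lemma reaches_Done k ts s : sumn (map task_cost ts) <= k ->
  exists c, reaches k.+1
      (conf Main (flatten (map task_code ts)) [::] s (fun=> [::])) c /\
    phase_answer c.1 = Some (answer_of (foldl exec s ts)).
Proof.
elim/ltn_ind: k ts s => k IHk [|t ts] s le_k.
  exists (conf (Done (answer_of s)) [::] [::] s (fun=> [::])); split=> //.
  apply: (@reaches_leq 1) => //.
  by apply: (reaches_conf1 keep keep keep (fun=> keep)) => //=; case: (s).
case: t le_k => [u v|a] le_k.
  have le_uv := cost_subtasks u v; rewrite /= in le_k.
  set K := (script_bound + 10) * (size u + size v).+1 in le_uv.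
  have K_gt0 : 0 < K by rewrite muln_gt0 addnS.
  have [||c [run_c ans_c]] := IHk (sumn (map task_cost (subtasks u v ++ ts)))
    _ (subtasks u v ++ ts) s.
  - by rewrite map_cat sumn_cat; lia.
  - by [].
  exists c; split; last by rewrite ans_c foldl_cat exec_subtasks.
  apply: (@reaches_leq (K + (sumn (map task_cost (subtasks u v ++ ts))).+1)).
    by rewrite map_cat sumn_cat; lia.
  apply: reaches_trans run_c.
  have := @reaches_task u v (inr End :: flatten (map task_code ts)) s isT.
  by rewrite run_script /= map_cat flatten_cat -!catA /= -!catA.
have step_to s' : reaches 2
    (conf Main (flatten (map task_code (Symbol a :: ts))) [::] s (fun=> [::]))
    (conf Main (flatten (map task_code ts)) [::] s' (fun=> [::])) ->
    foldl exec s (Symbol a :: ts) = foldl exec s' ts ->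
  exists c, reaches k.+1 (conf Main (flatten (map task_code (Symbol a :: ts)))
      [::] s (fun=> [::])) c /\
    phase_answer c.1 = Some (answer_of (foldl exec s (Symbol a :: ts))).
  move=> run_s' ->; rewrite /= in le_k.
  have [|//|c [run_c ans_c]] := IHk (sumn (map task_cost ts)) _ ts s'.
    by lia.
  exists c; split=> //; apply: reaches_leq (reaches_trans run_s' run_c); lia.
case: a {le_k} step_to => [|x|o|o] step_to.
- apply: (step_to s) => //; apply: (@reaches_leq 1) => //.
  exact: (reaches_conf1 pop keep keep (fun=> keep)).
- apply: (step_to (x :: s)) => //; apply: (@reaches_leq 1) => //.
  exact: (reaches_conf1 pop keep (Push (value_sym x)) (fun=> keep)).
- apply: (step_to (exec s (Symbol (Un o)))) => //.
  apply: (@reaches_leq 1) => //.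
  apply: (reaches_conf1 pop keep (if s is x :: _ then
    Replace (value_sym (eval1 o x)) else keep) (fun=> keep)) => //;
    by case: (s).
case: s step_to => [|x s] step_to.
  apply: (step_to [::]) => //; apply: (@reaches_leq 1) => //.
  exact: (reaches_conf1 pop keep pop (fun=> keep)).
apply: (step_to (exec (x :: s) (Symbol (Bin o)))) => //.
have run_o : reaches 1 (conf (Operand o x) (flatten (map task_code ts)) [::] s
    (fun=> [::]))
  (conf Main (flatten (map task_code ts)) [::]
    (if s is y :: s'' then eval2 o x y :: s'' else s) (fun=> [::])).
  apply: (reaches_conf1 keep keep (if s is y :: _ then
    Replace (value_sym (eval2 o x y)) else keep) (fun=> keep)) => //;
    by case: (s).
exact: (reaches_conf pop keep pop (fun=> keep) run_o).
Qed.

Definition tm := stack_tm Main phase_answer trans.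

Lemma tm_answers u v :
  answers_within tm (encode_pair u v) (cost u v).+1.*2 (accept (solve u v)).
Proof.
have le_uv := cost_subtasks u v.
set K := (script_bound + 10) * (size u + size v).+1 in le_uv.
have [c [run_c ans_c]] :=
  reaches_Done [::] (leqnn (sumn (map task_cost (subtasks u v)))).
have := @reaches_task u v [::] [::] isT; rewrite cats0 run_script cats0.
move=> /reaches_trans /(_ run_c) [j]; rewrite -/K => le_j def_c.
have [|k le_k ans_k] := @stack_tm_answers _ _ _ _ Main phase_answer trans
    (encode_pair u v) j (accept (solve u v)).
  have -> : stack_init work_stack task_symbol Main (encode_pair u v) =
      conf Main (map letter_sym u ++ separator :: map letter_sym v) [::] [::]
        (fun=> [::]).
    congr pair; apply/funext => -[[[]|x]|] //=.
    by rewrite map_cat /= -!map_comp.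
  by rewrite def_c ans_c exec_subtasks.
by exists k => //; apply: leq_trans le_k _; rewrite leq_double; lia.
Qed.

End DivideAndConquer.

Arguments End {value op1 op2}.
Arguments Val {value op1 op2}.
Arguments Un {value op1 op2}.
Arguments Bin {value op1 op2}.
Arguments Emit {value op1 op2}.
Arguments Unload {value op1 op2}.
Arguments Pair {value op1 op2}.
Arguments Symbol {value op1 op2}.

(** * Conjugacy and sections in the Grigorchuk group *)

Section Grigorchuk.
Local Open Scope group_scope.

Local Notation val := aut_of_word.

(** * Words as elements of the group *)

Lemma aut_of_nil : val [::] = 1.
Proof. by rewrite /aut_of_word big_nil. Qed.

Lemma aut_of_cons l w : val (l :: w) = aut_of_letter l * val w.
Proof. by rewrite /aut_of_word big_cons. Qed.

Lemma aut_of_cat u v : val (u ++ v) = val u * val v.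
Proof. by rewrite /aut_of_word big_cat. Qed.

Lemma aut_of_letterK l : aut_of_letter l * aut_of_letter l = 1.
Proof.
apply: tree_autP => w; case: l => /=;
  [exact: act_aK | exact: act_bK | exact: act_cK | exact: act_dK].
Qed.

Lemma aut_of_letterV l : (aut_of_letter l)^-1 = aut_of_letter l.
Proof. by rewrite -[LHS]mulg1 -(aut_of_letterK l) mulKg. Qed.

Lemma act_bcd_mul w : [/\ act_b (act_c w) = act_d w, act_c (act_d w) = act_b w
  & act_d (act_b w) = act_c w].
Proof.
elim: w => [|[] w [bc cd db]] //=; first by rewrite bc cd db.
by rewrite act_aK.
Qed.

Lemma aut_bcd_mul : [/\ aut_b * aut_c = aut_d, aut_c * aut_d = aut_b
  & aut_d * aut_b = aut_c].
Proof. by split; apply: tree_autP => w; case: (act_bcd_mul w). Qed.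

Lemma aut_of_fuse x y : aut_of_letter y * aut_of_letter x =
  match fuse x y with
  | None => aut_of_letter y * aut_of_letter x
  | Some None => 1
  | Some (Some z) => aut_of_letter z
  end.
Proof.
have [bc cd db] := aut_bcd_mul.
have swap l m n : aut_of_letter l * aut_of_letter m = aut_of_letter n ->
    aut_of_letter m * aut_of_letter l = aut_of_letter n.
  by move=> e; rewrite -[LHS]invgK invgM !aut_of_letterV e aut_of_letterV.
have cb := swap Lb Lc Ld bc; have dc := swap Lc Ld Lb cd.
have bd := swap Ld Lb Lc db.
by case: x y => [] [] //=; rewrite ?(aut_of_letterK La) ?(aut_of_letterK Lb)
  ?(aut_of_letterK Lc) ?(aut_of_letterK Ld).
Qed.

(** Letters are involutions, so the reversal made by [reduce] inverts the element; [conjugatesV]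
    makes this harmless. *)
Lemma aut_of_reduce u : val (reduce u) = (val u)^-1.
Proof.
suff gen s : val (foldl push_letter s u) = (val u)^-1 * val s.
  by rewrite gen aut_of_nil mulg1.
elim: u s => [|l u IHu] s /=; first by rewrite aut_of_nil invg1 mul1g.
rewrite IHu aut_of_cons invgM aut_of_letterV -mulgA; congr (_ * _).
case: s => [|y s] /=; first by rewrite aut_of_cons.
have := aut_of_fuse y l; rewrite aut_of_cons mulgA.
by case: fuse => [[z|]|] e; rewrite ?aut_of_cons e ?mul1g ?mulgA.
Qed.

(** Turns identities between explicit words into computations. *)
Lemma eq_reduce u v : reduce u = reduce v -> val u = val v.
Proof.
by move=> e; rewrite -[LHS]invgK -aut_of_reduce e aut_of_reduce invgK.
Qed.

Definition in_group (x : tree_aut) : Prop := exists w, x = val w.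

Lemma in_groupM x y : in_group x -> in_group y -> in_group (x * y).
Proof. by move=> [u ->] [v ->]; exists (u ++ v); rewrite aut_of_cat. Qed.

Lemma in_groupV x : in_group x -> in_group x^-1.
Proof. by move=> [u ->]; exists (reduce u); rewrite aut_of_reduce. Qed.

Lemma in_group_letter l : in_group (aut_of_letter l).
Proof. by exists [:: l]; rewrite aut_of_cons aut_of_nil mulg1. Qed.

Lemma grigorchukP x : grigorchuk x <-> in_group x.
Proof.
split=> [|[w ->]].
  apply: classical_sets.smallest_sub.
    split; [|exact: in_groupM|exact: in_groupV].
    by exists [::]; rewrite aut_of_nil.
  move=> g [] ->; [exact: (in_group_letter La)|exact: (in_group_letter Lb)|..].
    exact: (in_group_letter Lc).
  exact: (in_group_letter Ld).
move=> H [[H1 HM HV] gens].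
elim: w => [|l w IHw]; first by rewrite aut_of_nil.
rewrite aut_of_cons; apply: HM => //; apply: gens.
by case: l => /=; [constructor 1|constructor 2|constructor 3|constructor 4].
Qed.

(** * Action on the two subtrees: parities and sections *)

Definition sections (x : tree_aut) (s : bool) (f : bool -> tree_aut) : Prop :=
  forall p w, x (p :: w) = (p (+) s) :: f p w.

Lemma sectionsM x y s t f h : sections x s f -> sections y t h ->
  sections (x * y) (t (+) s) (fun p => f (p (+) t) * h p).
Proof.
move=> dx dy p w; rewrite -[LHS]/(x (y (p :: w))) dy dx.
by rewrite addbA.
Qed.

Lemma sections_eq x s t f h :
  sections x s f -> s = t -> f =1 h -> sections x t h.
Proof. by move=> dx <- fh p w; rewrite dx fh. Qed.

Lemma sections_inj x y s f : sections x s f -> sections y s f -> x = y.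
Proof.
move=> dx dy; apply: tree_autP => -[|p w]; first by rewrite !aut_root.
by rewrite dx dy.
Qed.

Lemma sections_fun x s t f h :
  sections x s f -> sections x t h -> s = t /\ f =1 h.
Proof.
move=> dx dh; split=> [|p]; first by have := dx false [::]; rewrite dh => -[].
by apply: tree_autP => w; have := dx p w; rewrite dh => -[].
Qed.

Lemma sections1 : sections 1 false (fun=> 1).
Proof. by move=> p w; rewrite addbF. Qed.

Lemma sectionsV x s f : sections x s f ->
  sections x^-1 s (fun p => (f (p (+) s))^-1).
Proof.
move=> dx p w; apply: (can_inj (aut_funK x)).
rewrite -[LHS]/((x * x^-1) (p :: w)) mulgV dx -addbA addbb addbF.
rewrite -[f _ _]/((f _ * (f _)^-1) w) mulgV //.
Qed.

Definition is_a (l : letter) : bool := if l is La then true else false.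

Definition section_letter (l : letter) (p : bool) : option letter :=
  match l with
  | La => None
  | Lb => Some (if p then Lc else La)
  | Lc => Some (if p then Ld else La)
  | Ld => if p then Some Lb else None
  end.

Lemma sections_letter l : sections (aut_of_letter l) (is_a l)
  (fun p => oapp aut_of_letter 1 (section_letter l p)).
Proof. by case: l => -[] w. Qed.

Definition parity : seq letter -> bool :=
  foldr (fun l b => is_a l (+) b) false.

(* With [s = false] and [p = q (+) parity r], this is the section of [r] at
   [q]: indexing by where a branch ends lets [r] be read from left to right. *)
Fixpoint section (s p : bool) (r : seq letter) : seq letter :=
  if r is l :: r' then
    let t := section (s (+) is_a l) p r' in
    if section_letter l (p (+) s) is Some x then x :: t else t
  else [::].

(** [section s p] depends only on [p (+) s]; the free [s] serves the induction, since each [La]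
    flips it. *)
Lemma sections_word s r : sections (val r) (parity r)
  (fun q => val (section s (q (+) parity r (+) s) r)).
Proof.
elim: r s => [|l r IHr] s.
  by rewrite /= aut_of_nil; exact: sections1.
rewrite aut_of_cons.
apply: (sections_eq (sectionsM (sections_letter l) (IHr (s (+) is_a l)))) => /=.
  by rewrite addbC.
move=> q.
have -> : q (+) (is_a l (+) parity r) (+) s = q (+) parity r (+) (s (+) is_a l).
  by case: q; case: (is_a l); case: parity; case: s.
have -> : q (+) parity r (+) (s (+) is_a l) (+) s = q (+) parity r (+) is_a l.
  by case: q; case: (is_a l); case: parity; case: s.
case: l => /=; rewrite ?addbT ?addbF ?mul1g //; case: (q (+) _) => //=;
  by rewrite ?aut_of_cons ?mul1g.
Qed.

(** * The subgroup K *)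

Definition abab : seq letter := [:: La; Lb; La; Lb].

(** Conjugating only the generator, and only by words, keeps K inside the group; [in_K_conj]
    recovers normality. *)
Inductive in_K : tree_aut -> Prop :=
  | in_K1 : in_K 1
  | in_KM x y : in_K x -> in_K y -> in_K (x * y)
  | in_KV x : in_K x -> in_K x^-1
  | in_KJ w : in_K (val abab ^ val w).

Lemma in_K_group x : in_K x -> in_group x.
Proof.
elim=> [|y z _ Iy _ Iz|y _ Iy|w].
- by exists [::]; rewrite aut_of_nil.
- exact: in_groupM.
- exact: in_groupV.
rewrite conjgE; apply: in_groupM; first by apply: in_groupV; eexists.
by apply: in_groupM; eexists.
Qed.

Lemma in_K_conj x g : in_group g -> in_K x -> in_K (x ^ g).
Proof.
move=> [u ->]; elim=> [|y z _ Iy _ Iz|y _ Iy|w].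
- by rewrite conj1g; exact: in_K1.
- by rewrite conjMg; exact: in_KM.
- by rewrite conjVg; exact: in_KV.
by rewrite -conjgM -aut_of_cat; exact: in_KJ.
Qed.

Lemma sectionsJ x s f y h : sections x s f -> sections y false h ->
  sections (x ^ y) s (fun p => (h (p (+) s))^-1 * (f p * h p)).
Proof.
move=> dx dy; rewrite conjgE.
apply: sections_eq (sectionsM (sectionsV dy) (sectionsM dx dy)) _ _ => /=.
  by rewrite addbF.
by move=> p; rewrite !addbF.
Qed.

Lemma sections_group x : in_group x ->
  exists s f, sections x s f /\ forall p, in_group (f p).
Proof.
move=> [w ->]; exists (parity w).
exists (fun q => val (section false (q (+) parity w (+) false) w)).
by split=> [|p]; [exact: sections_word | eexists].
Qed.

(** The substitution a -> b, b -> ada, c -> aba, d -> aca gives words that fix the first level and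
    whose section at [false] is the original word. *)
Lemma lift_group x : in_group x -> exists y f,
  [/\ in_group y, sections y false f & f false = x].
Proof.
move=> [w ->]; pose lift := foldr (fun l => cat match l with
  | La => [:: Lb] | Lb => [:: La; Ld; La]
  | Lc => [:: La; Lb; La] | Ld => [:: La; Lc; La]
  end) [::].
have lift_even v : parity (lift v) = false.
  by elim: v => //= l v; case: l => /= ->.
exists (val (lift w)).
exists (fun q =>
  val (section false (q (+) parity (lift w) (+) false) (lift w))).
split; [by eexists| |].
  by have := sections_word false (lift w); rewrite {1}lift_even.
rewrite lift_even /=; congr val; elim: w => //= l w IHw.
by case: l => /=; rewrite IHw.
Qed.

(* K x 1 lies in K because K is normally generated by (ab)^2 and
   (b a d a)^2, itself in K, has sections (ab)^2 and 1. *)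
Lemma lift_K_left x : in_K x -> exists2 y, in_K y &
  sections y false (fun p => if p then 1 else x).
Proof.
elim=> [|y z _ [y' Ky' dy'] _ [z' Kz' dz']|y _ [y' Ky' dy']|w].
- by exists 1; [exact: in_K1 | apply: (sections_eq sections1) => // -[]].
- exists (y' * z'); first exact: in_KM.
  by apply: (sections_eq (sectionsM dy' dz')) => // -[] /=; rewrite ?mulg1.
- exists y'^-1; first exact: in_KV.
  by apply: (sections_eq (sectionsV dy')) => // -[] /=; rewrite ?invg1.
have [h [f [gh dh fw]]] := lift_group (ex_intro _ w erefl).
(* [b] has sections [a], [c] and [ada] has sections [b], 1; hence (bada)^2 has sections (ab)^2 and
   c^2 = 1. *)
pose badabada := [:: Lb; La; Ld; La; Lb; La; Ld; La].
have Kbada : in_K (val badabada).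
  (* The two words agree because b d b = d. *)
  have -> : val badabada =
      val abab ^ val [:: Ld; La; Lb] * val abab ^ val [:: Lb].
    have e u v : val u ^ val v = val (reduce v ++ u ++ v).
      by rewrite conjgE !aut_of_cat aut_of_reduce.
    by rewrite !e -aut_of_cat; apply: eq_reduce.
  by apply: in_KM; exact: in_KJ.
exists (val badabada ^ h); first exact: in_K_conj.
apply: (sections_eq (sectionsJ (sections_word false _) dh)) => // -[] /=.
  have -> : val [:: Lc; Lc] = 1 by rewrite -aut_of_nil; apply: eq_reduce.
  by rewrite mul1g mulVg.
by rewrite fw conjgE.
Qed.

(** Conjugation by [a] carries a lift from the left subtree to the right one. *)
Lemma lift_K k : (forall p, in_K (k p)) ->
  exists2 y, in_K y & sections y false k.
Proof.
move=> Kk; have [y0 Ky0 dy0] := lift_K_left (Kk false).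
have [y1 Ky1 dy1] := lift_K_left (Kk true).
have ga : in_group aut_a := in_group_letter La.
exists (y0 * y1 ^ aut_a); first by apply: in_KM => //; exact: in_K_conj.
have da := sections_letter La; rewrite /= in da.
have dya := sectionsM (sectionsV da) (sectionsM dy1 da).
apply: (sections_eq (sectionsM dy0 dya)) => // -[] /=;
  by rewrite ?invg1 ?mul1g ?mulg1.
Qed.

(** * Cosets of K and their representatives *)

Definition same_coset (x y : tree_aut) : Prop := in_K (x * y^-1).

Lemma same_refl x : same_coset x x.
Proof. by rewrite /same_coset mulgV; exact: in_K1. Qed.

Lemma same_sym x y : same_coset x y -> same_coset y x.
Proof. by move=> /in_KV; rewrite invgM invgK. Qed.

Lemma same_trans y x z : same_coset x y -> same_coset y z -> same_coset x z.
Proof. by move=> xy yz; have := in_KM xy yz; rewrite mulgA mulgVK. Qed.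

Lemma same_group x y : same_coset x y -> in_group y -> in_group x.
Proof. by move=> /in_K_group xy /(in_groupM xy); rewrite mulgVK. Qed.

Lemma sameM x x' y y' : in_group x' ->
  same_coset x x' -> same_coset y y' -> same_coset (x * y) (x' * y').
Proof.
move=> gx' xx' yy'; apply: (@same_trans (x' * y)).
  by rewrite /same_coset invgM mulgA mulgK.
have := in_K_conj (in_groupV gx') yy'.
by rewrite conjgE invgK /same_coset invgM !mulgA.
Qed.

Lemma sameV x y : in_group x -> same_coset x y -> same_coset x^-1 y^-1.
Proof.
move=> gx /same_sym xy; have := in_K_conj gx xy.
by rewrite conjgE mulgVK /same_coset invgK.
Qed.

Definition alternating : seq letter := [:: La; Ld; La; Ld; La; Ld; La; Ld].

(** Modulo K, [b] commutes with [a] and [d], and c = bd, so each coset contains b^i g with g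
    generated by [a] and [d]. As (ad)^4 = 1, such g are the eight proper prefixes of
    [alternating]. *)
Definition coset_rep := (bool * 'I_8)%type.

Definition rep_word (c : coset_rep) : seq letter :=
  nseq c.1 Lb ++ take c.2 alternating.

Definition rep (c : coset_rep) : tree_aut := val (rep_word c).

Lemma in_group_rep c : in_group (rep c).
Proof. by eexists. Qed.

(** (ad)^2 has section [b] on both subtrees, and b^2 = 1. *)
Lemma aut_of_alternating : val alternating = 1.
Proof.
have -> : val alternating = val [:: La; Ld; La; Ld] * val [:: La; Ld; La; Ld].
  by rewrite -aut_of_cat.
have dx := sections_word false [:: La; Ld; La; Ld].
apply: (sections_inj _ sections1).
apply: (sections_eq (sectionsM dx dx)) => // p /=.
have bb : val [:: Lb] * val [:: Lb] = 1.
  by rewrite -aut_of_cat -aut_of_nil; exact: eq_reduce.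
by case: p.
Qed.

(** Odd prefixes end in [a], nonempty even ones in [d], so the new letter is cancelled or appended;
    for [d], the indices 0 and 7 wrap around by (ad)^4 = 1. *)
Lemma alternating_step j l : j < 8 -> l = La \/ l = Ld ->
  exists2 j', j' < 8 &
    val (take j alternating) * aut_of_letter l = val (take j' alternating).
Proof.
move=> lt_j def_l; have e : aut_of_letter l = val [:: l].
  by rewrite aut_of_cons aut_of_nil mulg1.
rewrite e -aut_of_cat; case: def_l => -> {e l}.
  exists (if odd j then j.-1 else j.+1).
    by case: j lt_j => [|[|[|[|[|[|[|[|j]]]]]]]] //.
  by apply: eq_reduce; case: j lt_j => [|[|[|[|[|[|[|[|j]]]]]]]] //.
exists (if odd j then if j == 7 then 0 else j.+1
        else if j == 0 then 7 else j.-1).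
  by case: j lt_j => [|[|[|[|[|[|[|[|j]]]]]]]] //.
have [-> /=|j0] := eqVneq j 0.
  rewrite -[LHS]mul1g -aut_of_alternating -aut_of_cat; exact: eq_reduce.
have [-> /=|j7] := eqVneq j 7.
  by rewrite aut_of_nil -aut_of_alternating; exact: eq_reduce.
by apply: eq_reduce; case: j lt_j j0 j7 => [|[|[|[|[|[|[|[|j]]]]]]]] //.
Qed.

Definition is_ad (l : letter) : bool :=
  match l with La | Ld => true | _ => false end.

(** (ab)^2 in K makes [a] and [b] commute modulo K; [b] and [d] commute outright. *)
Lemma same_swap_b w : all is_ad w ->
  same_coset (val w * aut_b) (aut_b * val w).
Proof.
elim: w => [_|l w IHw] /=.
  by rewrite aut_of_nil mul1g mulg1; exact: same_refl.
move=> /andP[ad_l ad_w]; rewrite aut_of_cons.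
have gl := in_group_letter l; have gb : in_group aut_b := in_group_letter Lb.
apply: (@same_trans (aut_of_letter l * (aut_b * val w))).
  rewrite -mulgA; apply: sameM (same_refl _) (IHw ad_w) => //.
rewrite !mulgA; apply: sameM (same_refl _).
  exact: in_groupM.
case: l ad_l gl => //= _ _.
  have := in_KJ [::]; rewrite aut_of_nil conjg1 !aut_of_cons aut_of_nil mulg1.
  by rewrite /same_coset invgM (aut_of_letterV La) (aut_of_letterV Lb) !mulgA.
suff -> : aut_d * aut_b = aut_b * aut_d by exact: same_refl.
by rewrite (aut_of_fuse Lb Ld) (aut_of_fuse Ld Lb).
Qed.

Lemma rep_step c l : exists c', same_coset (rep c * aut_of_letter l) (rep c').
Proof.
have ad_step c1 m : m = La \/ m = Ld ->
    exists c', rep c1 * aut_of_letter m = rep c'.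
  case: c1 => i j /(alternating_step (ltn_ord j))[j' lt_j' e].
  by exists (i, Ordinal lt_j'); rewrite /rep /rep_word !aut_of_cat -mulgA e.
have b_step c1 : exists c', same_coset (rep c1 * aut_b) (rep c').
  case: c1 => i j; exists (~~ i, j).
  rewrite /rep /rep_word !aut_of_cat /= -mulgA.
  apply: (@same_trans (val (nseq i Lb) * (aut_b * val (take j alternating)))).
    apply: sameM (same_refl _) (same_swap_b _); first by eexists.
    by case: j => [[|[|[|[|[|[|[|[|j]]]]]]]] lt_j].
  rewrite mulgA; case: i; rewrite /= ?aut_of_cons ?aut_of_nil ?mulg1 ?mul1g.
    by rewrite (aut_of_letterK Lb) mul1g; exact: same_refl.
  exact: same_refl.
case: l => /=.
- by have [|c' ->] := ad_step c La; [left | exists c'; exact: same_refl].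
- exact: b_step.
- have [c1 bc1] := b_step c; have [|c2 e] := ad_step c1 Ld; first by right.
  have bd : aut_b * aut_d = aut_c := aut_of_fuse Ld Lb.
  exists c2; rewrite -e -bd mulgA; apply: sameM bc1 (same_refl _).
  exact: in_group_rep.
- by have [|c' ->] := ad_step c Ld; [right | exists c'; exact: same_refl].
Qed.

(** Chosen classically; being a map between finite types, it can still be wired into a machine. The
    default [c] never arises, by [rep_step]. *)
Definition coset_step (c : coset_rep) (l : letter) : coset_rep :=
  odflt c [pick c' | `[< same_coset (rep c * aut_of_letter l) (rep c') >]].

Definition coset (w : seq letter) : coset_rep :=
  foldl coset_step (false, ord0) w.

Lemma same_coset_step c l :
  same_coset (rep c * aut_of_letter l) (rep (coset_step c l)).
Proof.
rewrite /coset_step; case: pickP => [c' /asboolP //|none].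
by have [c' /asboolP] := rep_step c l; rewrite none.
Qed.

Lemma same_coset_word w : same_coset (val w) (rep (coset w)).
Proof.
have: same_coset (val [::]) (rep (false, ord0)) by exact: same_refl.
rewrite -{1}[w]cat0s /coset; elim: w [::] (false, ord0) => [|l w IHw] u c uc /=.
  by rewrite cats0.
rewrite -cat_rcons; apply: IHw.
rewrite -cats1 aut_of_cat aut_of_cons aut_of_nil mulg1.
apply: same_trans (same_coset_step c l).
by apply: sameM (same_refl _) => //; exact: in_group_rep.
Qed.

Lemma rep_exists x : in_group x -> exists c, same_coset x (rep c).
Proof. by move=> [w ->]; exists (coset w); exact: same_coset_word. Qed.

(** * Cosets that contain conjugators *)

Definition conjugates (u v : tree_aut) (c : coset_rep) : Prop :=
  exists2 x, same_coset x (rep c) & x * u = v * x.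

Lemma conjugatesV u v c : conjugates u^-1 v^-1 c <-> conjugates u v c.
Proof.
suff half u' v' : conjugates u' v' c -> conjugates u'^-1 v'^-1 c.
  by split=> [/half|/half //]; rewrite !invgK.
move=> [x xc xu]; exists x => //.
by rewrite -[LHS](mulKg v'); congr (_ * _); rewrite mulgA -xu mulgK.
Qed.

(* Which cosets contain an element of the given parity whose sections lie in
   two given cosets; as K x K <= K, any two sections in these will then do. *)
Definition coset_sections (s : bool) (c : tree_aut) (c0 c1 : tree_aut) : Prop :=
  exists x f, [/\ same_coset x c, sections x s f,
    same_coset (f false) c0 & same_coset (f true) c1].

(** The sections of a given witness are corrected by an element of K, which [lift_K] provides. *)
Lemma coset_sections_lift s c c0 c1 x0 x1 : coset_sections s c c0 c1 ->
  same_coset x0 c0 -> same_coset x1 c1 ->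
  exists2 x, same_coset x c & sections x s (fun p => if p then x1 else x0).
Proof.
move=> [y [f [yc dy f0 f1]]] x0c0 x1c1.
(* The section of [z * y] at [p] is that of [z] at [p (+) s] times [f p], which dictates [k]. *)
pose k p := let q := p (+) s in (if q then x1 else x0) * (f q)^-1.
have [|z Kz dz] := @lift_K k.
  move=> p; rewrite /k /=; case: (p (+) s).
    exact: same_trans x1c1 (same_sym f1).
  exact: same_trans x0c0 (same_sym f0).
exists (z * y).
  by apply: same_trans yc; rewrite /same_coset mulgK.
apply: (sections_eq (sectionsM dz dy)); first by rewrite addbF.
by move=> p; rewrite /k -addbA addbb addbF mulgVK.
Qed.

Definition even_conjugates s u v c : Prop :=
  exists x f, [/\ same_coset x (rep c), x * u = v * x & sections x s f].

Lemma conjugates_parity u v c : conjugates u v c <->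
  even_conjugates false u v c \/ even_conjugates true u v c.
Proof.
split=> [[x xc xu]|[] [x [f [xc xu dx]]]]; try by exists x.
have [s [f [dx _]]] := sections_group (same_group xc (in_group_rep c)).
by case: s dx => dx; [right | left]; exists x, f.
Qed.

(** On sections, x u = v x reads f_p u_p = v_(p + s) f_p, one independent equation per subtree. *)
Lemma even_conjugatesP s u v fu fv c :
  sections u false fu -> sections v false fv ->
  even_conjugates s u v c <-> exists c0 c1,
    [/\ conjugates (fu false) (fv s) c0, conjugates (fu true) (fv (~~ s)) c1
      & coset_sections s (rep c) (rep c0) (rep c1)].
Proof.
move=> du dv; split=> [[x [f [xc xu dx]]]|]; last first.
  move=> [c0 [c1 [[x0 xc0 xu0] [x1 xc1 xu1] cs]]].
  have [x xc dx] := coset_sections_lift cs xc0 xc1.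
  exists x, (fun p => if p then x1 else x0); split=> //.
  apply: (sections_inj (sectionsM dx du)).
  apply: (sections_eq (sectionsM dv dx)); first by rewrite addbF.
  by case.
have [s' [f' [dx' gf']]] := sections_group (same_group xc (in_group_rep c)).
have [_ ff'] := sections_fun dx dx'.
have gf p : in_group (f p) by rewrite ff'.
have [c0 f0c0] := rep_exists (gf false).
have [c1 f1c1] := rep_exists (gf true).
have := sectionsM dx du; rewrite xu.
move=> /sections_fun/(_ (sectionsM dv dx))[_ e].
exists c0, c1; split; last by exists x, f.
  by exists (f false) => //; exact: e false.
by exists (f true) => //; exact: e true.
Qed.

(* If x conjugates, so does x u; hence for odd u the parity of x is free. *)
Definition odd_relation (cu cu0 cv0 c c0 : coset_rep) : Prop :=
  let c1 := rep cv0 * rep c0 * (rep cu0)^-1 in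
  coset_sections false (rep c) (rep c0) c1 \/
  coset_sections false (rep c * rep cu) (rep c0) c1.

(** For even x, x u = v x reads f_1 u_0 = v_0 f_0 and f_0 u_1 = v_1 f_1. So f_0 conjugates u_1 u_0
    to v_1 v_0, and f_1 = v_0 f_0 u_0^-1 is determined. *)
Lemma odd_conjugatesP u v fu fv cu cu0 cv0 c :
  same_coset u (rep cu) -> same_coset (fu false) (rep cu0) ->
  same_coset (fv false) (rep cv0) ->
  sections u true fu -> sections v true fv ->
  conjugates u v c <-> exists2 c0,
    conjugates (fu true * fu false) (fv true * fv false) c0
    & odd_relation cu cu0 cv0 c c0.
Proof.
move=> ucu u0cu0 v0cv0 du dv.
have gu0 := same_group u0cu0 (in_group_rep _).
have gu := same_group ucu (in_group_rep _).
have same_c1 x0 c0 : same_coset x0 (rep c0) ->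
    same_coset (fv false * x0 * (fu false)^-1)
               (rep cv0 * rep c0 * (rep cu0)^-1).
  move=> x0c0; apply: sameM (sameV _ u0cu0) => //.
    by apply: in_groupM; exact: in_group_rep.
  by apply: sameM => //; exact: in_group_rep.
split=> [[x xc xu] | [c0 [x0 x0c0 x0u] rel_c]].
  have even_case y f c' : same_coset y c' -> in_group y -> y * u = v * y ->
      sections y false f -> exists2 c0,
      conjugates (fu true * fu false) (fv true * fv false) c0
      & coset_sections false c' (rep c0) (rep cv0 * rep c0 * (rep cu0)^-1).
    move=> yc' gy yu dy.
    have [s' [f' [dy' gf']]] := sections_group gy.
    have [_ ff'] := sections_fun dy dy'.
    have [c0 f0c0] := rep_exists (gf' false); rewrite -ff' in f0c0.
    have := sectionsM dy du; rewrite yu.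
    move=> /sections_fun/(_ (sectionsM dv dy))[_ e].
    have := e false; have := e true; rewrite /= => e1 e0.
    exists c0.
      by exists (f false) => //; rewrite mulgA e1 -mulgA e0 mulgA.
    exists y, f; split=> //; have := same_c1 _ _ f0c0.
    by rewrite -e0 mulgK.
  have gx := same_group xc (in_group_rep c).
  have [s [f [dx _]]] := sections_group gx.
  case: s dx => dx; last first.
    by have [c0 ? ?] := even_case _ _ _ xc gx xu dx; exists c0 => //; left.
  have [|||c0 ? ?] :=
    even_case (x * u) _ (rep c * rep cu) _ _ _ (sectionsM dx du).
  - by apply: sameM => //; exact: in_group_rep.
  - exact: in_groupM.
  - by rewrite {1}xu mulgA.
  by exists c0 => //; right.
pose c1 := rep cv0 * rep c0 * (rep cu0)^-1.
have lift c' : coset_sections false c' (rep c0) c1 ->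
    exists2 x, same_coset x c' & x * u = v * x.
  move=> /coset_sections_lift/(_ x0c0 (same_c1 _ _ x0c0))[x xc' dx].
  exists x => //; apply: (sections_inj (sectionsM dx du)).
  apply: (sections_eq (sectionsM dv dx)) => // -[] /=; last by rewrite mulgVK.
  by rewrite !mulgA -x0u mulgA mulgK.
case: rel_c => /lift[x xc xu]; first by exists x.
exists (x * u^-1); last by rewrite mulgVK mulgA -xu mulgK.
rewrite -[rep c](mulgK (rep cu)); apply: sameM (sameV _ ucu) => //.
by apply: in_groupM; exact: in_group_rep.
Qed.

End Grigorchuk.

(** * The decision procedure *)

Section Algorithm.
Local Open Scope nat_scope.

Local Notation val := aut_of_word.

(* With these weights the sections of a letter other than a weigh together at
   most 14/17 of the letter and an a, while [fuse] does not increase weight. *)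
Definition letter_weight (l : letter) : nat :=
  match l with La => 10 | Lb => 11 | Lc => 7 | Ld => 4 end.

Definition weight (w : seq letter) : nat := sumn (map letter_weight w).

Lemma weight_cons l w : weight (l :: w) = letter_weight l + weight w.
Proof. by []. Qed.

Lemma weight_cat u v : weight (u ++ v) = weight u + weight v.
Proof. by rewrite /weight map_cat sumn_cat. Qed.

Lemma size_leq_weight w : size w <= weight w.
Proof.
by elim: w => //= l w IHw; rewrite weight_cons; case: l => /=; lia.
Qed.

Lemma weight_leq_size w : weight w <= 11 * size w.
Proof.
by elim: w => //= l w IHw; rewrite weight_cons; case: l => /=; lia.
Qed.

Lemma weight_reduce u : weight (reduce u) <= weight u.
Proof.
suff gen s : weight (foldl push_letter s u) <= weight s + weight u.
  exact: gen.
elim: u s => [|l u IHu] s /=; first by rewrite addn0.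
apply: leq_trans (IHu _) _; rewrite weight_cons addnA leq_add2r.
case: s => [|y s] /=; first by rewrite !weight_cons; lia.
by rewrite weight_cons; case: y l => [] [] /=; rewrite ?weight_cons /=; lia.
Qed.

Definition reduced : seq letter -> bool :=
  sorted (fun x y => ~~ isSome (fuse x y)).

Lemma reduce_reduced u : reduced (reduce u).
Proof.
rewrite /reduce; have : reduced [::] by [].
elim: u [::] => //= l u IHu s red_s; apply: IHu.
case: s red_s => [|y [|z s]] //=; first by case: y l => [] [].
by case: y l z => [] [] [].
Qed.

(** In a reduced word each b, c or d is paid for jointly with the [a] before it; 14/17 is attained
    at ac. A first letter without its [a] costs the extra 140 = 14 x 10. *)
Lemma weight_section s r : reduced r ->
  17 * (weight (section s false r) + weight (section s true r)) <=
  14 * weight r + (if r is La :: _ then 0 else 140).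
Proof.
elim: r s => //= l r IHr s red_r.
have {}IHr := IHr (s (+) is_a l) (path_sorted red_r).
case: r red_r IHr => [_ _|y r].
  by case: l s => [] [].
rewrite !weight_cons; move: (section _ false _) (section _ true _) => t0 t1.
by case: l y s => [] [] [] //=; rewrite ?weight_cons /=; lia.
Qed.

Lemma weight_section_reduce s p u :
  17 * weight (section s p (reduce u)) <= 14 * weight u + 140.
Proof.
have := weight_section s (reduce_reduced u); have := weight_reduce u.
by case: p; case: (reduce u) => [|[] r]; lia.
Qed.

Lemma weight_sections_reduce s u :
  17 * (weight (section s false (reduce u)) +
        weight (section s true (reduce u)))
    <= 14 * weight u + 140.
Proof.
have := weight_section s (reduce_reduced u); have := weight_reduce u.
by case: (reduce u) => [|[] r]; lia.
Qed.

(** (5/6)^4 < 14/29, so 2 x^4 is at most 28/29 of m^4. One factor of 4 x^8 = (2 x^4)^2 is bounded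
    this way, the other by m^4. *)
Lemma pow8_decrease x m : 6 * x <= 5 * m -> 29 * (4 * x ^ 8) <= 28 * m ^ 8.
Proof.
move=> le_x.
have e n : n ^ 8 = (n ^ 4) * (n ^ 4) by rewrite -expnD.
have e4 n : n ^ 4 = (n * n) * (n * n) by rewrite !expnS expn0 muln1 !mulnA.
have le_x2 : 36 * (x * x) <= 25 * (m * m) by have := leq_mul le_x le_x; lia.
have le_x4 : 29 * (2 * x ^ 4) <= 28 * m ^ 4.
  by rewrite !e4; have := leq_mul le_x2 le_x2; lia.
rewrite !e; move: (x ^ 4) (m ^ 4) le_x4 => y z le_y.
have := leq_mul le_y (leqnn (2 * y)).
have : 2 * y <= z by lia.
move=> /(leq_mul (leqnn (28 * z))); lia.
Qed.

(* Beyond this weight [17 x <= 14 m + 280] implies [6 x <= 5 m]. *)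
Definition short_length : nat := 1680.

(** The factor 29 clears the denominator in [pow8_decrease], which frees 200 m^8 for the linear
    costs; 31 = 29 + 2 pays for an empty pair and one symbol. *)
Definition pair_cost (m : nat) : nat := 29 * 200 * m ^ 8 + 31.

Lemma leq_pow8 m : m <= m ^ 8.
Proof. by case: m => // m; rewrite expnS leq_pmulr // expn_gt0. Qed.

Lemma pair_cost_leaf n m : n <= m -> 29 * n.+1 + 2 <= pair_cost m.
Proof. by rewrite /pair_cost; have := leq_pow8 m; lia. Qed.

(** Pays for four pairs, the processing time, and 2 for each of the three operators of an even
    split. *)
Lemma pair_cost_decrease x m : short_length < m -> 17 * x <= 14 * m + 280 ->
  4 * pair_cost x + 29 * m.+1 + 6 <= pair_cost m.
Proof.
rewrite /short_length /pair_cost => lt_m le_x.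
have /pow8_decrease : 6 * x <= 5 * m by lia.
by have := leq_pow8 m; lia.
Qed.

(* The parity of the word read, its coset, the cosets of its sections, and the
   word itself as long as it is short. *)
Definition word_state := (bool * coset_rep * {ffun bool -> coset_rep} *
  option (short_length.-bseq letter))%type.

Definition state0 : word_state :=
  (false, (false, ord0), [ffun=> (false, ord0)], insub [::]).

Definition emit (i : word_state) (l : letter) (p : bool) : option letter :=
  section_letter l (p (+) i.1.1.1).

Definition state_step (i : word_state) (l : letter) : word_state :=
  (i.1.1.1 (+) is_a l, coset_step i.1.1.2 l,
   [ffun p => if emit i l p is Some x then coset_step (i.1.2 p) x else i.1.2 p],
   obind (fun w : short_length.-bseq letter => insub (rcons w l)) i.2).

Lemma emitted_section i p r :
  emitted state_step emit i p r = section i.1.1.1 p r.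
Proof.
by elim: r i => //= l r IHr i; rewrite IHr /emit; case: section_letter.
Qed.

Lemma foldl_state_step r : foldl state_step state0 r =
  (parity r, coset r, [ffun p => coset (section false p r)], insub r).
Proof.
suff gen s c f u : foldl state_step (s, c, f, insub u) r =
    (s (+) parity r, foldl coset_step c r,
     [ffun p => foldl coset_step (f p) (section s p r)], insub (u ++ r)).
  rewrite gen; congr (_, _, _, _); apply/ffunP => p; by rewrite !ffunE.
elim: r s c f u => [|l r IHr] s c f u /=.
  rewrite addbF cats0; congr (_, _, _, _); by apply/ffunP => p; rewrite ffunE.
rewrite /state_step /=.
have -> : obind (fun w : short_length.-bseq letter => insub (rcons w l))
      (insub u) = insub (rcons u l) :> option (short_length.-bseq letter).
  (* A prefix beyond the bound never becomes short again, so [None] persists. *)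
  case: insubP => [w _ <- //|long] /=; rewrite insubF //.
  by apply/negbTE; move: long; rewrite size_rcons -!ltnNge => /leqW.
rewrite IHr cat_rcons addbA; congr (_, _, _, _).
apply/ffunP => p; rewrite !ffunE /emit /=.
by case: section_letter.
Qed.

Definition solve (u v : seq letter) : {set coset_rep} :=
  finset (fun c => `[< conjugates (val u) (val v) c >]).

Lemma in_solve u v c : reflect (conjugates (val u) (val v) c) (c \in solve u v).
Proof. by rewrite inE; exact: asboolP. Qed.

Lemma solve_reduce u v : solve (reduce u) (reduce v) = solve u v.
Proof.
apply/setP => c; apply/in_solve/in_solve; rewrite !aut_of_reduce => ?;
  exact/conjugatesV.
Qed.

(** In an odd word the branch that ends at [true] starts at [false], so [i.1.2 true] is the coset of
    the section at [false]. *)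
Definition eval_odd (ij : word_state * word_state) (x : {set coset_rep}) :
    {set coset_rep} :=
  let: (i, j) := ij in
  finset (fun c => `[< exists2 c0, c0 \in x &
    odd_relation i.1.1.2 (i.1.2 true) (j.1.2 true) c c0 >]).

(* [Some s] handles the conjugators of parity [s]; [None] joins both cases. *)
Definition eval_even (o : option bool) (x y : {set coset_rep}) :
    {set coset_rep} :=
  if o is Some s then
    finset (fun c => `[< exists c0 c1, [/\ c0 \in y, c1 \in x &
      coset_sections s (rep c) (rep c0) (rep c1)] >])
  else y :|: x.

(** * Scripts and the subtasks they produce *)

Local Notation instr :=
  (instr {set coset_rep} (word_state * word_state)%type (option bool)).
Local Notation task :=
  (task {set coset_rep} (word_state * word_state)%type (option bool)).

Definition emit_pair (xs ys : seq buffer) : seq instr :=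
  Emit (inr End) :: map Unload ys ++ Emit (inl None) :: map Unload xs.

(* Scripts push, hence list the tasks backwards. *)
Definition even_script : seq instr :=
  [:: Emit (inr (Bin None)), Emit (inr (Bin (Some true))) &
  emit_pair [:: (false, true, true)] [:: (true, false, true)] ++
  emit_pair [:: (false, false, true)] [:: (true, true, true)] ++
  Emit (inr (Bin (Some false))) ::
  emit_pair [:: (false, true, false)] [:: (true, true, false)] ++
  emit_pair [:: (false, false, false)] [:: (true, false, false)]].

Definition odd_script (i j : word_state) : seq instr :=
  Emit (inr (Un (i, j))) ::
  emit_pair [:: (false, true, false); (false, false, false)]
            [:: (true, true, false); (true, false, false)].

Definition branch_script (i j : word_state) : seq instr :=
  if i.1.1.1 (+) j.1.1.1 then [:: Emit (inr (Val finset.set0))]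
  else if i.1.1.1 then odd_script i j else even_script.

Definition script (i j : word_state) : seq instr :=
  match i.2, j.2 with
  | Some u, Some v => [:: Emit (inr (Val (solve u v)))]
  | _, _ => branch_script i j
  end.

(** The longest script, [even_script], has three operators and four pairs of four instructions
    each. *)
Lemma script_size i j : size (script i j) <= 19.
Proof.
rewrite /script /branch_script; case: (i.2) (j.2) => [a|] [b|] //;
  by case: (_ (+) _) => //; case: (i.1.1.1).
Qed.

Local Notation state_of := (word_info state0 state_step).

(** The sections of [u] at [true] are treated second, so their value is on top and becomes the first
    operand of [eval_even]. *)
Definition branch_tasks (u v : seq letter) : seq task :=
  let r := reduce u in let t := reduce v in
  if parity r (+) parity t then [:: Symbol (Val finset.set0)]
  else if parity r then
    [:: Pair (section false false r ++ section false true r)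
             (section false false t ++ section false true t);
        Symbol (Un (state_of u, state_of v))]
  else
    [:: Pair (section false false r) (section false false t);
        Pair (section false true r) (section false true t);
        Symbol (Bin (Some false));
        Pair (section false false r) (section false true t);
        Pair (section false true r) (section false false t);
        Symbol (Bin (Some true)); Symbol (Bin None)].

Definition subtasks (u v : seq letter) : seq task :=
  let r := reduce u in let t := reduce v in
  if (size r <= short_length) && (size t <= short_length)
  then [:: Symbol (Val (solve r t))] else branch_tasks u v.

Lemma run_branch_script u v w :
  run (branch_script (state_of u) (state_of v)) w
    (split_buffers state0 state_step emit u v) =
  flatten (map (@task_code _ _ _) (branch_tasks u v)) ++ w.
Proof.
have e x : rev (split_buffers state0 state_step emit u v x) =
    section false x.1.2 (reduce (if x.1.1 then v else u)).
  by rewrite revK emitted_section.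
have parity_of u' : (state_of u').1.1.1 = parity (reduce u').
  by rewrite /word_info foldl_state_step.
rewrite /branch_script /branch_tasks !parity_of.
case: (parity _ (+) _) => //; case: (parity _);
  by rewrite /= !e /= ?map_cat; do 9 rewrite -?catA /=.
Qed.

Lemma run_script u v w :
  run (script (state_of u) (state_of v)) w
    (split_buffers state0 state_step emit u v) =
  flatten (map (@task_code _ _ _) (subtasks u v)) ++ w.
Proof.
have state_word u' : (state_of u').2 = insub (reduce u').
  by rewrite /word_info foldl_state_step.
have := run_branch_script u v w; rewrite /script /subtasks !state_word.
case: insubP => [a le_a def_a|/negbTE -> //].
case: insubP => [b le_b def_b|/negbTE ->]; last by rewrite andbF.
by rewrite le_a le_b /= -def_a -def_b.
Qed.

Lemma exec_branch_tasks u v s :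
  foldl (exec eval_odd eval_even solve) s (branch_tasks u v) = solve u v :: s.
Proof.
rewrite -[solve u v]solve_reduce /branch_tasks.
set r := reduce u; set t := reduce v.
have dr := sections_word false r; have dt := sections_word false t.
(* Conjugate elements have the same parity. *)
have [pp|] := boolP (parity r (+) parity t).
  congr cons; apply/setP => c; rewrite !inE.
  apply/esym/negP => /asboolP[x xc xr].
  have [s' [f [dx _]]] := sections_group (same_group xc (in_group_rep c)).
  have := sectionsM dx dr; rewrite xr => /sections_fun/(_ (sectionsM dt dx))[].
  by move: pp; case: (parity r) (parity t) s' {dx} => [] [] [].
have state_word u' : state_of u' = (parity (reduce u'), coset (reduce u'),
    [ffun p => coset (section false p (reduce u'))], insub (reduce u')).
  by rewrite /word_info foldl_state_step.
move=> /negPf pp; have ept : parity t = parity r.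
  by move: pp; case: (parity r) (parity t) => [] [].
rewrite ept in dt *; have [odd_r|/negPf even_r] := boolP (parity r) => /=.
  congr cons; apply/setP => c; rewrite !inE; apply: asbool_equiv_eq.
  rewrite !state_word -/r -/t /= !ffunE; rewrite odd_r in dr dt.
  rewrite (odd_conjugatesP c (same_coset_word r) _ _ dr dt);
    try exact: same_coset_word.
  rewrite /= -!aut_of_cat.
  by split=> -[c0 c0r rel_c]; exists c0 => //; apply/in_solve.
congr cons; apply/setP => c; rewrite !inE; rewrite even_r in dr dt.
apply/orP/asboolP => [cases|/conjugates_parity cases].
  apply/conjugates_parity.
  case: cases => /asboolP[c0 [c1 [/in_solve q0 /in_solve q1 cs]]];
  [left|right]; apply/(even_conjugatesP _ c dr dt); by exists c0, c1.
case: cases => /(even_conjugatesP _ c dr dt)[c0 [c1 [q0 q1 cs]]]; [left|right];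
  apply/asboolP; exists c0, c1; split=> //; exact/in_solve.
Qed.

Lemma exec_subtasks u v s :
  foldl (exec eval_odd eval_even solve) s (subtasks u v) = solve u v :: s.
Proof.
rewrite /subtasks; case: ifP => _; last exact: exec_branch_tasks.
by rewrite /= solve_reduce.
Qed.

(** * Cost of the recursion *)

Definition cost (u v : seq letter) : nat := pair_cost (weight u + weight v).

Lemma leq_pair_cost : {homo pair_cost : m n / m <= n}.
Proof.
by move=> m n le_mn; rewrite leq_add2r leq_mul2l leq_exp2r // le_mn orbT.
Qed.

Lemma cost_subtasks u v :
  (19 + 10) * (size u + size v).+1 +
    sumn (map (task_cost cost) (subtasks u v)) <= cost u v.
Proof.
have size_u := size_leq_weight u; have size_v := size_leq_weight v.
have leaf := pair_cost_leaf (leq_add size_u size_v).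
rewrite /subtasks; case: ifP => [//|long].
have long_m : short_length < weight u + weight v.
  have size_ru := size_leq_weight (reduce u).
  have size_rv := size_leq_weight (reduce v).
  have le_u := weight_reduce u; have le_v := weight_reduce v.
  by move: long => /negbT; rewrite negb_and -!ltnNge => /orP[]; lia.
(* The largest weight that the contraction allows for a subproblem: each word contributes 140 to the
   280. *)
pose x := (14 * (weight u + weight v) + 280) %/ 17.
have le_x y : 17 * y <= 14 * (weight u + weight v) + 280 ->
    pair_cost y <= pair_cost x.
  by move=> le_y; apply: leq_pair_cost; rewrite leq_divRL // mulnC.
have decr : 4 * pair_cost x + 29 * (weight u + weight v).+1 + 6 <= cost u v.
  by apply: pair_cost_decrease => //; rewrite mulnC leq_trunc_div.
rewrite /branch_tasks; case: (parity _ (+) _); first exact: leaf.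
case: (parity _) => /=.
  (* The odd subproblem concatenates both sections, so their joint weight has to contract. *)
  have su := weight_sections_reduce false u.
  have sv := weight_sections_reduce false v.
  set y := cost (_ ++ _) (_ ++ _).
  have : y <= pair_cost x by apply: le_x; rewrite !weight_cat; lia.
  lia.
have sub p q : cost (section false p (reduce u)) (section false q (reduce v))
    <= pair_cost x.
  have su := weight_section_reduce false p u.
  have sv := weight_section_reduce false q v.
  by apply: le_x; lia.
have := sub false false; have := sub true true.
have := sub false true; have := sub true false.
lia.
Qed.

Lemma solve_neq0 u v : solve u v != finset.set0 <-> conjugate_in_grigorchuk u v.
Proof.
split=> [/set0Pn[c /in_solve[x xc xu]] | [x /grigorchukP/rep_exists[c xc] xu]].
  exists x; first by apply/grigorchukP; exact: same_group xc (in_group_rep c).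
  by rewrite -mulgA -xu mulKg.
apply/set0Pn; exists c; apply/in_solve; exists x => //.
by rewrite xu -mulgA mulVKg.
Qed.

End Algorithm.

Theorem theorem4p6 :
  exists T : nat -> nat,
    big_O T (fun n => n ^ 8) /\ decidable_in_time conjugate_in_grigorchuk T.
Proof.
(* A letter weighs at most 11, and simulating the stacks doubles the time. *)
exists (fun n => (pair_cost (11 * n)).+1.*2); split.
  exists (2 * (29 * 200 * 11 ^ 8 + 32)), 1 => n n_gt0.
  have : 0 < n ^ 8 by rewrite expn_gt0 n_gt0.
  rewrite /pair_cost expnMn mulnA.
  by move: (29 * 200 * 11 ^ 8) (n ^ 8) => k m; nia.
exists (@tm _ _ _ _ 19 script state0 state_step emit eval_odd eval_even
  (fun x => x != finset.set0)) => u v.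
exists (solve u v != finset.set0); last exact: solve_neq0.
have [k le_k ans] := tm_answers script_size (fun x => x != finset.set0)
  run_script exec_subtasks cost_subtasks u v.
exists k => //; apply: leq_trans le_k _; rewrite leq_double ltnS.
by apply: leq_pair_cost; rewrite mulnDr leq_add ?weight_leq_size.
Qed.
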